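(* Let $\mathbf{k}$ be a field, let $X=\{x_1,\dots,x_m\}$ and $Y=\{y_1,\dots,y_n\}$ be finite sets, $m,n\ge2$, let $f\in\mathrm{Sym}(X)$, $\varphi\in\mathrm{Sym}(Y)$, and let $(X,r_f)$, $(Y,r_\varphi)$ be the corresponding permutation idempotent solutions. Let $A\circ B$ be the Segre product of their Yang-Baxter algebras $A=\mathcal{A}(\mathbf{k},X,r_f)$ and $B=\mathcal{A}(\mathbf{k},Y,r_\varphi)$, and let $(X\circ Y,r_{X\circ Y})$ be the Cartesian product of the solutions. (1) $A\circ B$ is a PBW algebra with a set of $mn$ PBW one-generators $\mathcal{W}=X\circ Y$ ordered lexicographically, $$\mathcal{W}=\{w_{11}=x_1\circ y_1<w_{12}=x_1\circ y_2<\cdots<w_{1n}=x_1\circ y_n<\cdots<w_{mn}=x_m\circ y_n\},$$ and a finite standard presentation $A\circ B=\mathbf{k}\langle\mathcal{W}\rangle/(\Re)$, where $$\Re=\{F_{jb,ia}=w_{jb}w_{ia}-w_{11}w_{ia}\mid(j,b)\ne(1,1),\ 1\le i,j\le m,\ 1\le a,b\le n\}$$ is a set of $mn(mn-1)$ quadratic relations. The leading monomial of each $F_{jb,ia}$ is $w_{jb}w_{ia}$. Moreover, $\Re$ is a reduced Gröbner basis of the ideal $I=(\Re)$ of the free associative algebra $\mathbf{k}\langle\mathcal{W}\rangle$. (2) The ideal $I$ has a second set of generators, $I=(\Re(A\circ B))$, where $$\Re(A\circ B)=\{f_{jb,ia}=w_{jb}w_{ia}-\Psi(w_{ia})w_{ia}\mid1\le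 i,j\le m,\ 1\le a,b\le n\},$$ and $\Psi\in\mathrm{Sym}(\mathcal{W})$ is given by $\Psi(x_i\circ y_a)=f(x_i)\circ\varphi(y_a)$ for all $i\in\{1,\dots,m\}$, $a\in\{1,\dots,n\}$. (3) The Segre product $A\circ B$ is isomorphic to the Yang-Baxter algebra $\mathcal{A}(\mathbf{k},X\circ Y,r_{X\circ Y})$ of the Cartesian product $(X\circ Y,r_{X\circ Y})$.
   Context: For a finite set $Z$ and $g\in\mathrm{Sym}(Z)$, the permutation idempotent solution $(Z,r_g)$ is $r_g(x,y)=(g(y),y)$ on $Z\times Z$, and its Yang-Baxter algebra is $\mathcal{A}(\mathbf{k},Z,r_g)=\mathbf{k}\langle Z\rangle/(xy-g(y)y\mid x,y\in Z)$, graded by word length. The Segre product of $\mathbb{N}_0$-graded algebras $A,B$ with $A_0=B_0=\mathbf{k}$ is the graded algebra $A\circ B=\bigoplus_{i\ge0}A_i\otimes_{\mathbf{k}}B_i$, a subalgebra of $A\otimes_{\mathbf{k}}B$. Notation: $x\circ y:=x\otimes y$ for $x\in X,y\in Y$; $X\circ Y=\{x_i\circ y_a\mid1\le i\le m,1\le a\le n\}\subset A_1\otimes B_1$. The Cartesian product solution $(X\circ Y,r_{X\circ Y})$ is $r_{X\circ Y}(x_j\circ y_b,x_i\circ y_a)=(f(x_i)\circ\varphi(y_a),\,x_i\circ y_a)$, i.e. it is the permutation idempotent solution $r_\Psi$. Gröbner bases and leading monomials in $\mathbf{k}\langle\mathcal{W}\rangle$ are with respect to the degree-lexicographic order extending the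 given order on $\mathcal{W}$. An algebra $\mathbf{k}\langle\mathcal{W}\rangle/I$ is PBW with PBW-generators $\mathcal{W}$ (in this order) if $I$ has a Gröbner basis of homogeneous quadratic polynomials. A Gröbner basis $G$ of $I$ is reduced if no $G\setminus\{g\}$ is a Gröbner basis of $I$ and each $g\in G$ is a linear combination of monomials containing no leading monomial of $G\setminus\{g\}$ as a subword. *)

(* Defs.v *)
From HB Require Import structures.
From mathcomp Require Import all_boot all_order all_algebra.
From mathcomp Require Import boolp classical_sets cardinality.
From mathcomp Require Import perm finmap monalg.

Set Implicit Arguments.
Unset Strict Implicit.
Unset Printing Implicit Defensive.

Import Order.TTheory GRing.Theory.
Local Open Scope ring_scope.

(* A connected grading A = \bigoplus_d A_d, with A_0 = k, is carried by the
   projections hcomp d onto the summands; thus A_d is the set of the a with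
   hcomp d a = a. *)
HB.mixin Record isGraded (k : fieldType) A of GRing.Algebra k A := {
  hcomp : nat -> A -> A;
  hcomp_is_linear : forall d, linear (hcomp d);
  hcompK : forall d e a, hcomp d (hcomp e a) = if d == e then hcomp e a else 0;
  hcomp_sum : forall a, exists N, a = \sum_(d < N) hcomp d a;
  hcompM : forall d e a b,
    hcomp (d + e)%N (hcomp d a * hcomp e b) = hcomp d a * hcomp e b;
  hcomp1 : hcomp 0 1 = 1;
  hcomp0_scalar : forall a, exists c, hcomp 0 a = c%:A
}.

#[short(type="grAlgType")]
HB.structure Definition GradedAlgebra (k : fieldType) :=
  {A of isGraded k A & GRing.Algebra k A}.

Definition homogeneous {k : fieldType} {A : grAlgType k} (d : nat) (a : A) :=
  hcomp d a = a.

Definition graded_isomorphic {k : fieldType} (A B : grAlgType k) : Prop :=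
  exists phi : {lrmorphism A -> B},
    bijective phi /\ forall d a, phi (hcomp d a) = hcomp d (phi a).

Section GradedTheory.
Context (k : fieldType) (A : grAlgType k).
Implicit Types (a b : A) (d e : nat).

HB.instance Definition _ d := GRing.isLinear.Build k A A *:%R
  (@hcomp k A d) (@hcomp_is_linear k A d).

Lemma hcomp_sumW a : exists N, forall M, (N <= M)%N ->
  a = \sum_(d < M) hcomp d a.
Proof.
have [N aE] := hcomp_sum a; exists N => M leNM.
rewrite {1}aE (big_ord_widen M (fun d => hcomp d a) leNM) big_mkcond /=.
apply: eq_bigr => d _; case: ltnP => // leNd.
rewrite [in RHS]aE linear_sum /= big1 // => e _.
rewrite hcompK; case: eqP => // /esym dE.
by move: (ltn_ord e); rewrite dE ltnNge leNd.
Qed.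

Lemma hcompM_eq n d e a b : hcomp n (hcomp d a * hcomp e b) =
  if n == (d + e)%N then hcomp d a * hcomp e b else 0.
Proof. by rewrite -hcompM hcompK. Qed.

Lemma hcompMM n d e l s a b : homogeneous l s ->
  hcomp n (hcomp d a * s * hcomp e b) =
  if n == (d + l + e)%N then hcomp d a * s * hcomp e b else 0.
Proof.
move=> homs.
have E : hcomp d a * s = hcomp (d + l)%N (hcomp d a * s).
  by rewrite -homs hcompM.
by rewrite E hcompM_eq -E.
Qed.

Lemma homogeneousB d a b :
  homogeneous d a -> homogeneous d b -> homogeneous d (a - b).
Proof. by move=> ha hb; rewrite /homogeneous linearB /= ha hb. Qed.

Lemma homogeneousM d e a b :
  homogeneous d a -> homogeneous e b -> homogeneous (d + e) (a * b).
Proof. by move=> ha hb; rewrite /homogeneous -ha -hb hcompM. Qed.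

Fact aug_ex a : exists c : k, hcomp 0 a == c%:A.
Proof. by have [c ->] := hcomp0_scalar a; exists c. Qed.

Definition aug a : k := xchoose (aug_ex a).

Lemma augE a : (aug a)%:A = hcomp 0 a.
Proof. by rewrite -(eqP (xchooseP (aug_ex a))). Qed.

Lemma scalar_inj (c c' : k) : c%:A = c'%:A :> A -> c = c'.
Proof.
move/eqP; rewrite -subr_eq0 -scalerBl scaler_eq0 oner_eq0 orbF subr_eq0.
by move/eqP.
Qed.

Fact aug_is_linear : linear_for *%R aug.
Proof.
by move=> c a b; apply: scalar_inj;
  rewrite augE linearP /= -!augE scalerDl scalerA.
Qed.

Lemma aug1 : aug 1 = 1.
Proof. by apply: scalar_inj; rewrite augE hcomp1 scale1r. Qed.

End GradedTheory.

HB.lock Definition mlift (k : fieldType) (K : choiceType) (V : lmodType k)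
  (f : K -> V) (g : {malg k[K]}) : V := \sum_(x <- msupp g) g@_x *: f x.

Section LinearExtension.
Context (k : fieldType) (K : choiceType).

Lemma malg_lin_ind (P : {malg k[K]} -> Prop) :
  P 0 -> (forall c x g, P g -> P (c *: << x >> + g)) -> forall g, P g.
Proof.
move=> P0 PD g; rewrite [g]monalgE.
elim/big_rec: _ => // x h _ Ph.
suff -> : << g@_x *g x >> = g@_x *: << x >> :> {malg k[K]} by apply: PD.
by apply/malgP => y; rewrite mcoeffZ !mcoeffU mulr_natr.
Qed.

Context (V : lmodType k).
Implicit Types (f : K -> V) (g h : {malg k[K]}).

Lemma mliftEw f g (D : {fset K}) : (msupp g `<=` D)%fset ->
  mlift f g = \sum_(x <- D) g@_x *: f x.
Proof.
move=> le; rewrite mlift.unlock [LHS](big_fset_incl _ le)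
  => //= x xd /mcoeff_outdom ->.
by rewrite scale0r.
Qed.

Fact mlift_is_linear f : linear (mlift f).
Proof.
move=> c g h; pose D := (msupp g `|` msupp h `|` msupp (c *: g + h))%fset.
have gD : (msupp g `<=` D)%fset by rewrite /D -fsetUA fsubsetUl.
have hD : (msupp h `<=` D)%fset by rewrite /D fsetUAC fsubsetUr.
have ghD : (msupp (c *: g + h) `<=` D)%fset by rewrite /D fsubsetUr.
rewrite (mliftEw f gD) (mliftEw f hD) (mliftEw f ghD).
rewrite scaler_sumr -big_split; apply: eq_bigr => x _ /=.
by rewrite mcoeffD mcoeffZ scalerDl scalerA.
Qed.

HB.instance Definition _ f :=
  GRing.isLinear.Build k {malg k[K]} V *:%R (mlift f) (mlift_is_linear f).

Lemma mliftU f x : mlift f << x >> = f x.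
Proof. by rewrite (mliftEw f msuppU_le) big_seq_fset1 mcoeffUU scale1r. Qed.

End LinearExtension.

Section GradingFromBasis.
Context (k : fieldType) (F : algType k) (M : monomType) (w : M -> F).
Context (deg : M -> nat) (h : nat -> F -> F).
Hypothesis wind : forall P : F -> Prop,
  P 0 -> (forall c u p, P p -> P (c *: w u + p)) -> forall p, P p.
Hypothesis w1 : w (@mone M) = 1.
Hypothesis wM : forall u v, w u * w v = w (mmul u v).
Hypothesis degM : forall u v, deg (mmul u v) = (deg u + deg v)%N.
Hypothesis deg_eq0 : forall u, (deg u == 0%N) = (u == @mone M).
Hypothesis h_linear : forall d, linear (h d).
Hypothesis h_basis : forall d u, h d (w u) = if deg u == d then w u else 0.

Let h0 d : h d 0 = 0.
Proof.
by have := h_linear d (-1) 0 0; rewrite scaler0 addr0 scaleN1r addNr.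
Qed.

Fact basis_hcompK d e p :
  h d (h e p) = if d == e then h e p else 0.
Proof.
elim/wind: p => [|c u p IH]; first by rewrite !h0 if_same.
rewrite !h_linear /= IH h_basis.
have -> : h d (if deg u == e then w u else 0) =
  if d == e then (if deg u == e then w u else 0) else 0.
  case: (deg u =P e) => [<-|_]; last by rewrite h0 if_same.
  by rewrite h_basis eq_sym.
by case: eqP => // _; rewrite scaler0 addr0.
Qed.

Fact basis_hcomp_sum p : exists N, p = \sum_(d < N) h d p.
Proof.
suff [N /(_ N (leqnn N)) pE] : exists N, forall M, (N <= M)%N ->
    p = \sum_(d < M) h d p by exists N.
elim/wind: p => [|c u p [N IH]].
  by exists 0%N => L _; rewrite big1 // => d _; rewrite h0.
exists (maxn N (deg u).+1) => L; rewrite geq_max => /andP[leN ltu].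
under eq_bigr do rewrite h_linear /=.
rewrite big_split -IH //= -scaler_sumr; congr (_ *: _ + _).
rewrite (bigD1 (Ordinal ltu)) //= h_basis eqxx big1 ?addr0 // => d neq.
rewrite h_basis; case: eqP => // uE; case/eqP: neq.
exact: val_inj.
Qed.

Fact basis_hcompM d e p q :
  h (d + e)%N (h d p * h e q) =
  h d p * h e q.
Proof.
elim/wind: p => [|c u p IH]; first by rewrite !(h0, mul0r).
rewrite [h d _]h_linear /= mulrDl -scalerAl h_linear /= IH.
congr (_ *: _ + _); rewrite h_basis.
case: eqP => [uE|_]; last by rewrite !(mul0r, h0).
elim/wind: q {p IH} => [|b v q IH]; first by rewrite !(h0, mulr0).
rewrite [h e _]h_linear /= mulrDr -scalerAr h_linear /= IH.
congr (_ *: _ + _); rewrite h_basis.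
case: eqP => [vE|_]; last by rewrite !(mulr0, h0).
by rewrite wM h_basis degM uE vE eqxx.
Qed.

Fact basis_hcomp1 : h 0 1 = 1.
Proof. by rewrite -w1 h_basis deg_eq0 eqxx. Qed.

Fact basis_hcomp0 p : exists c, h 0 p = c%:A.
Proof.
elim/wind: p => [|c u p [b IH]]; first by exists 0; rewrite h0 scale0r.
rewrite h_linear /= IH h_basis.
case: eqP => [/eqP|_]; last by exists b; rewrite scaler0 add0r.
by rewrite deg_eq0 => /eqP->; rewrite w1; exists (c + b); rewrite scalerDl.
Qed.

End GradingFromBasis.

Fact malg_scalerAr (k : fieldType) (M : monomType) (c : k)
  (p q : {malg k[M]}) : c *: (p * q) = p * (c *: q).
Proof.
apply/malgP => w; rewrite mcoeffZ.
rewrite (mcoeffMlw w (fsubset_refl _) (fsubset_refl _)).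
rewrite (mcoeffMlw w (fsubset_refl (msupp p)) (msuppZ_le c q)).
rewrite mulr_sumr; apply: eq_bigr => u _.
rewrite mulr_sumr; apply: eq_bigr => v _.
by rewrite mcoeffZ mulrnAr mulrCA.
Qed.

Definition free_alg (k : fieldType) (Z : choiceType) : Type :=
  {malg k[{fmonom Z}]}.

Section FreeAlgebra.
Context (k : fieldType) (Z : choiceType).
Local Notation F := (free_alg k Z).

HB.instance Definition _ := GRing.Lalgebra.on F.

Definition word (u : {fmonom Z}) : F := << u >>.
Definition var (z : Z) : F := word (fmu z).

Lemma free_ind (P : F -> Prop) :
  P 0 -> (forall c u p, P p -> P (c *: word u + p)) -> forall p, P p.
Proof. exact: malg_lin_ind. Qed.

Lemma wordM u v : word u * word v = word (fmmul u v).
Proof. by apply: etrans (fgmulUU _ _ _ _) _; rewrite mulr1. Qed.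

Fact free_scalerAr (c : k) (p q : F) : c *: (p * q) = p * (c *: q).
Proof. exact: malg_scalerAr. Qed.

HB.instance Definition _ := GRing.Lalgebra_isAlgebra.Build k F free_scalerAr.

Definition free_hcomp (d : nat) : F -> F :=
  mlift (fun u : {fmonom Z} => if fdeg u == d then word u else 0).

Lemma free_hcomp_linear d : linear (free_hcomp d).
Proof. exact: mlift_is_linear. Qed.

HB.instance Definition _ d := GRing.isLinear.Build k F F *:%R
  (free_hcomp d) (free_hcomp_linear d).

Lemma free_hcomp_word d u :
  free_hcomp d (word u) = if fdeg u == d then word u else 0.
Proof. exact: mliftU. Qed.

Lemma word1 : word (@mone _) = 1.
Proof. by []. Qed.

HB.instance Definition _ := isGraded.Build k F free_hcomp_linear
  (basis_hcompK free_ind free_hcomp_linear free_hcomp_word)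
  (basis_hcomp_sum free_ind free_hcomp_linear free_hcomp_word)
  (basis_hcompM free_ind wordM (@fdegM Z) free_hcomp_linear free_hcomp_word)
  (basis_hcomp1 word1 (@fdeg_eq0 Z) free_hcomp_word)
  (basis_hcomp0 free_ind word1 (@fdeg_eq0 Z) free_hcomp_linear free_hcomp_word).

End FreeAlgebra.

Inductive ideal_gen {R : nzRingType} (S : set R) : R -> Prop :=
| ideal_gen0 : ideal_gen S 0
| ideal_genD p q : ideal_gen S p -> ideal_gen S q -> ideal_gen S (p + q)
| ideal_genM a s b : S s -> ideal_gen S (a * s * b).

Section IdealTheory.
Context (R : nzRingType) (S : set R).

Lemma ideal_gen_sub s : S s -> ideal_gen S s.
Proof. by move=> Ss; rewrite -[s]mul1r -[_ * s]mulr1; apply: ideal_genM. Qed.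

Lemma ideal_genMM a p b : ideal_gen S p -> ideal_gen S (a * p * b).
Proof.
elim=> [|q r _ IHq _ IHr|c s d Ss]; first by rewrite mulr0 mul0r; constructor.
  by rewrite mulrDr mulrDl; constructor.
by rewrite !mulrA -mulrA; apply: ideal_genM.
Qed.

Definition ideal_pred : {pred R} := fun p => `[< ideal_gen S p >].

Lemma ideal_predP p : reflect (ideal_gen S p) (p \in ideal_pred).
Proof. exact: asboolP. Qed.

Fact ideal_pred_zmod_closed : zmod_closed ideal_pred.
Proof.
split=> [|p q /ideal_predP Ip /ideal_predP Iq]; apply/ideal_predP.
  exact: ideal_gen0.
apply: ideal_genD => //.
by rewrite -[- q]mulN1r -[_ * q]mulr1; apply: ideal_genMM.
Qed.

HB.instance Definition _ :=
  GRing.isZmodClosed.Build R ideal_pred ideal_pred_zmod_closed.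

End IdealTheory.

Record relators (k : fieldType) (R : grAlgType k) := Relators {
  relset :> set R;
  relset_homogeneous :
    forall s, relset s -> exists2 d, (0 < d)%N & homogeneous d s
}.

Definition quot_alg {k : fieldType} {R : grAlgType k} (S : relators R) : Type :=
  Quotient.quot (ideal_pred S).

Section QuotientAlgebra.
Context (k : fieldType) (R : grAlgType k) (S : relators R).
Local Notation I := (ideal_gen S).
Local Notation Q := (quot_alg S).
Implicit Types (p q : R) (x y z : Q).

HB.instance Definition _ := GRing.Zmodule.on Q.

Definition quot_pi (p : R) : Q := \pi_(Quotient.quot (ideal_pred S))%qT p.
Local Notation "[ p ]" := (quot_pi p) (format "[ p ]").

Fact quot_pi_is_zmod_morphism : zmod_morphism quot_pi.
Proof. exact: pi_is_zmod_morphism. Qed.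

HB.instance Definition _ := GRing.isZmodMorphism.Build R Q quot_pi
  quot_pi_is_zmod_morphism.

Lemma quot_piP p q : [p] = [q] <-> I (p - q).
Proof.
split=> [pq|/ideal_predP]; last by rewrite Quotient.idealrBE => /eqP.
by apply/ideal_predP; rewrite Quotient.idealrBE; apply/eqP.
Qed.

Definition quot_repr (x : Q) : R := repr (x : Quotient.quot (ideal_pred S)).

Lemma quot_reprK x : [quot_repr x] = x.
Proof. exact: reprK. Qed.

Lemma quot_repr_pi p : I (quot_repr [p] - p).
Proof. by apply/quot_piP; rewrite quot_reprK. Qed.

Definition quot_scale (c : k) x : Q := [c *: quot_repr x].
Definition quot_mul x y : Q := [quot_repr x * quot_repr y].
Definition quot_hcomp d x : Q := [hcomp d (quot_repr x)].

Lemma quot_scaleE c p : quot_scale c [p] = [c *: p].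
Proof.
apply/quot_piP; rewrite -scalerBr -mulr_algl -[_ * _]mulr1.
by apply: ideal_genMM; apply: quot_repr_pi.
Qed.

Lemma quot_mulE p q : quot_mul [p] [q] = [p * q].
Proof.
apply/quot_piP; set p' := quot_repr _; set q' := quot_repr _.
have -> : p' * q' - p * q = 1 * (p' - p) * q' + p * (q' - q) * 1.
  by rewrite mul1r mulr1 mulrBl mulrBr addrA subrK.
by apply: ideal_genD; apply: ideal_genMM; apply: quot_repr_pi.
Qed.

Lemma ideal_hcomp p : I p -> forall d, I (hcomp d p).
Proof.
have Isum (J : finType) (G : J -> R) : (forall j, I (G j)) -> I (\sum_j G j).
  by move=> IG; elim/big_rec: _ => *; [apply: ideal_gen0|apply: ideal_genD].
elim=> [|q r _ IHq _ IHr|a s b Ss] d.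
- by rewrite linear0; apply: ideal_gen0.
- by rewrite linearD; apply: ideal_genD; [apply: IHq|apply: IHr].
have [e _ homs] := relset_homogeneous Ss.
have [N aE] := hcomp_sum a; have [M bE] := hcomp_sum b.
rewrite aE bE mulr_suml mulr_suml linear_sum; apply: (Isum) => i.
rewrite mulr_sumr linear_sum; apply: (Isum) => j.
rewrite /= (hcompMM _ _ _ _ _ homs).
by case: eqP => _; [apply: ideal_genM|apply: ideal_gen0].
Qed.

Lemma quot_hcompE d p : quot_hcomp d [p] = [hcomp d p].
Proof.
by apply/quot_piP; rewrite -linearB; apply/ideal_hcomp/quot_repr_pi.
Qed.

Lemma quot_ind (P : Q -> Prop) : (forall p, P [p]) -> forall x, P x.
Proof. by move=> PP x; rewrite -[x]quot_reprK. Qed.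

Fact quot_scaleA c d x : quot_scale c (quot_scale d x) = quot_scale (c * d) x.
Proof. by elim/quot_ind: x => p; rewrite !quot_scaleE scalerA. Qed.
Fact quot_scale1 : left_id 1 quot_scale.
Proof. by elim/quot_ind => p; rewrite quot_scaleE scale1r. Qed.
Fact quot_scaleDr : right_distributive quot_scale +%R.
Proof.
move=> c; elim/quot_ind => p; elim/quot_ind => q.
by rewrite -raddfD !quot_scaleE scalerDr raddfD.
Qed.
Fact quot_scaleDl x : {morph quot_scale^~ x : c d / c + d}.
Proof.
by move=> c d; elim/quot_ind: x => p; rewrite !quot_scaleE scalerDl raddfD.
Qed.

HB.instance Definition _ := GRing.Zmodule_isLmodule.Build k Q
  quot_scaleA quot_scale1 quot_scaleDr quot_scaleDl.

Fact quot_mulA : associative quot_mul.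
Proof.
elim/quot_ind => p; elim/quot_ind => q; elim/quot_ind => r.
by rewrite !quot_mulE mulrA.
Qed.
Fact quot_mul1l : left_id [1] quot_mul.
Proof. by elim/quot_ind => p; rewrite quot_mulE mul1r. Qed.
Fact quot_mul1r : right_id [1] quot_mul.
Proof. by elim/quot_ind => p; rewrite quot_mulE mulr1. Qed.
Fact quot_mulDl : left_distributive quot_mul +%R.
Proof.
elim/quot_ind => p; elim/quot_ind => q; elim/quot_ind => r.
by rewrite -raddfD !quot_mulE mulrDl raddfD.
Qed.
Fact quot_mulDr : right_distributive quot_mul +%R.
Proof.
elim/quot_ind => p; elim/quot_ind => q; elim/quot_ind => r.
by rewrite -raddfD !quot_mulE mulrDr raddfD.
Qed.

Fact quot_1_neq0 : [1] != 0.
Proof.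
apply/eqP; rewrite -[0](raddf0 quot_pi) => /quot_piP; rewrite subr0 => I1.
suff aug0 p : I p -> hcomp 0 p = 0.
  by have /eqP := aug0 _ I1; rewrite hcomp1 oner_eq0.
elim=> [|q r _ IHq _ IHr|a s b Ss]; first by rewrite linear0.
  by rewrite linearD /= IHq IHr addr0.
have [e e_gt0 homs] := relset_homogeneous Ss.
have [N aE] := hcomp_sum a; have [M bE] := hcomp_sum b.
rewrite aE bE mulr_suml mulr_suml linear_sum big1 // => i _.
rewrite mulr_sumr linear_sum big1 // => j _.
rewrite /= (hcompMM _ _ _ _ _ homs).
by case: eqP => // /esym/eqP; rewrite !addn_eq0 (gtn_eqF e_gt0) andbF.
Qed.

HB.instance Definition _ := GRing.Zmodule_isNzRing.Build Q
  quot_mulA quot_mul1l quot_mul1r quot_mulDl quot_mulDr quot_1_neq0.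

Fact quot_scaleAl (c : k) x y : c *: (x * y) = c *: x * y.
Proof.
elim/quot_ind: x => p; elim/quot_ind: y => q.
by rewrite -![_ *: _]/(quot_scale _ _) -![_ * _]/(quot_mul _ _)
  !(quot_mulE, quot_scaleE) scalerAl.
Qed.

HB.instance Definition _ := GRing.Lmodule_isLalgebra.Build k Q quot_scaleAl.

Fact quot_scaleAr (c : k) x y : c *: (x * y) = x * (c *: y).
Proof.
elim/quot_ind: x => p; elim/quot_ind: y => q.
by rewrite -![_ *: _]/(quot_scale _ _) -![_ * _]/(quot_mul _ _)
  !(quot_mulE, quot_scaleE) scalerAr.
Qed.

HB.instance Definition _ := GRing.Lalgebra_isAlgebra.Build k Q quot_scaleAr.

Lemma quot_piZ c p : [c *: p] = c *: [p].
Proof. by rewrite -quot_scaleE. Qed.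

Lemma quot_piM p q : [p * q] = [p] * [q].
Proof. by rewrite -quot_mulE. Qed.

Fact quot_pi_is_scalable : scalable quot_pi.
Proof. by move=> c p; rewrite quot_piZ. Qed.
HB.instance Definition _ :=
  GRing.isScalable.Build k R Q *:%R quot_pi quot_pi_is_scalable.

Fact quot_pi_is_monoid_morphism : monoid_morphism quot_pi.
Proof. by split=> // p q; rewrite quot_piM. Qed.
HB.instance Definition _ :=
  GRing.isMonoidMorphism.Build R Q quot_pi quot_pi_is_monoid_morphism.

Fact quot_hcomp_linear d : linear (quot_hcomp d).
Proof.
move=> c; elim/quot_ind => p; elim/quot_ind => q.
by rewrite -linearP !quot_hcompE !linearP.
Qed.
Fact quot_hcompK d e x :
  quot_hcomp d (quot_hcomp e x) = if d == e then quot_hcomp e x else 0.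
Proof.
elim/quot_ind: x => p; rewrite !quot_hcompE hcompK.
by case: eqP; rewrite ?raddf0.
Qed.
Fact quot_hcomp_sum x : exists N, x = \sum_(d < N) quot_hcomp d x.
Proof.
elim/quot_ind: x => p; have [N pE] := hcomp_sum p; exists N.
by rewrite {1}pE raddf_sum; apply: eq_bigr => d _; rewrite quot_hcompE.
Qed.
Fact quot_hcompM d e x y :
  quot_hcomp (d + e)%N (quot_hcomp d x * quot_hcomp e y) =
  quot_hcomp d x * quot_hcomp e y.
Proof.
elim/quot_ind: x => p; elim/quot_ind: y => q.
by rewrite (quot_hcompE d) (quot_hcompE e) -quot_piM quot_hcompE hcompM.
Qed.
Fact quot_hcomp1 : quot_hcomp 0 1 = 1.
Proof. by rewrite quot_hcompE hcomp1. Qed.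
Fact quot_hcomp0 x : exists c, quot_hcomp 0 x = c%:A.
Proof.
elim/quot_ind: x => p; have [c pE] := hcomp0_scalar p; exists c.
by rewrite quot_hcompE pE linearZ /= rmorph1.
Qed.

HB.instance Definition _ := isGraded.Build k Q quot_hcomp_linear quot_hcompK
  quot_hcomp_sum quot_hcompM quot_hcomp1 quot_hcomp0.

End QuotientAlgebra.

(* A \otimes_k B is the quotient of the vector space with basis A * B by the
   subspace bilinear_rel, the class of (a, b) being tens a b. *)
Inductive bilinear_rel {k : fieldType} {A B : lmodType k} :
    {malg k[(A * B)%type]} -> Prop :=
| bilinear_rel0 : bilinear_rel 0
| bilinear_relD c g h :
    bilinear_rel g -> bilinear_rel h -> bilinear_rel (c *: g + h)
| bilinear_rell c a a' b :
    bilinear_rel (<< (c *: a + a', b) >> - (c *: << (a, b) >> + << (a', b) >>))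
| bilinear_relr c a b b' :
    bilinear_rel (<< (a, c *: b + b') >> - (c *: << (a, b) >> + << (a, b') >>)).

Definition bilinear_pred {k : fieldType} (A B : lmodType k) :
  {pred {malg k[(A * B)%type]}} := fun g => `[< bilinear_rel g >].

Arguments bilinear_pred {k} A B.

Fact bilinear_pred_zmod_closed (k : fieldType) (A B : lmodType k) :
  zmod_closed (bilinear_pred A B).
Proof.
split=> [|g h /asboolP Ig /asboolP Ih]; apply/asboolP.
  exact: bilinear_rel0.
by rewrite addrC -scaleN1r; apply: bilinear_relD.
Qed.

HB.instance Definition _ (k : fieldType) (A B : lmodType k) :=
  GRing.isZmodClosed.Build _ (bilinear_pred A B)
    (@bilinear_pred_zmod_closed k A B).

Definition tensor {k : fieldType} (A B : lmodType k) : Type :=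
  Quotient.quot (bilinear_pred A B).

HB.lock Definition tens (k : fieldType) (A B : lmodType k) (a : A) (b : B) :
    tensor A B :=
  \pi_(Quotient.quot (bilinear_pred A B))%qT << (a, b) >>.

(* Only meaningful for a bilinear f, see tliftE and tlift_linear. *)
HB.lock Definition tlift (k : fieldType) (A B V : lmodType k) (f : A -> B -> V)
    (t : tensor A B) : V :=
  mlift (fun x : A * B => f x.1 x.2)
    (repr (t : Quotient.quot (bilinear_pred A B))).

Section TensorModule.
Context (k : fieldType) (A B : lmodType k).
Local Notation M := {malg k[(A * B)%type]}.
Local Notation T := (tensor A B).
Implicit Types (a : A) (b : B) (g h : M) (t u : T).

HB.instance Definition _ := GRing.Zmodule.on T.

Let cl g : T := \pi_(Quotient.quot (bilinear_pred A B))%qT g.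

Let tensE a b : tens a b = cl << (a, b) >>.
Proof. by rewrite tens.unlock. Qed.

Let clP g h : cl g = cl h <-> bilinear_rel (g - h).
Proof.
split=> [pq|Igh]; last by apply/eqP; rewrite -Quotient.idealrBE; apply/asboolP.
by apply/asboolP; have := Quotient.idealrBE (bilinear_pred A B) g h;
  rewrite -[_ \in _]/`[< bilinear_rel (g - h) >] => ->; apply/eqP.
Qed.

Let rp t : M := repr (t : Quotient.quot (bilinear_pred A B)).
Let rpK t : cl (rp t) = t. Proof. exact: reprK. Qed.
Let clB : {morph cl : g h / g - h}. Proof. exact: pi_is_zmod_morphism. Qed.
Let cl0 : cl 0 = 0. Proof. by have := clB 0 0; rewrite !subrr. Qed.
Let clD : {morph cl : g h / g + h}.
Proof.
by move=> g h; have := clB (g + h) h; rewrite addrK => ->; rewrite subrK.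
Qed.

Definition tensor_scale (c : k) t : T := cl (c *: rp t).

Let scaleE c g : tensor_scale c (cl g) = cl (c *: g).
Proof.
apply/clP; rewrite -scalerBr -[_ *: _]addr0.
by apply: bilinear_relD; [apply/clP; rewrite rpK|apply: bilinear_rel0].
Qed.

Let cl_ind (P : T -> Prop) : (forall g, P (cl g)) -> forall t, P t.
Proof. by move=> PP t; rewrite -[t]rpK. Qed.

Fact tensor_scaleA c d t :
  tensor_scale c (tensor_scale d t) = tensor_scale (c * d) t.
Proof. by elim/cl_ind: t => p; rewrite !scaleE scalerA. Qed.
Fact tensor_scale1 : left_id 1 tensor_scale.
Proof. by elim/cl_ind => p; rewrite scaleE scale1r. Qed.
Fact tensor_scaleDr : right_distributive tensor_scale +%R.
Proof.
by move=> c; elim/cl_ind => p; elim/cl_ind => q;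
  rewrite -clD !scaleE scalerDr clD.
Qed.
Fact tensor_scaleDl t : {morph tensor_scale^~ t : c d / c + d}.
Proof. by move=> c d; elim/cl_ind: t => p; rewrite !scaleE scalerDl clD. Qed.

HB.instance Definition _ := GRing.Zmodule_isLmodule.Build k T
  tensor_scaleA tensor_scale1 tensor_scaleDr tensor_scaleDl.

Let clZ c g : cl (c *: g) = c *: cl g. Proof. by rewrite -scaleE. Qed.

Fact tensPl c a a' b : tens (c *: a + a') b = c *: tens a b + tens a' b.
Proof. by rewrite !tensE -clZ -clD; apply/clP/bilinear_rell. Qed.

Fact tensPr c a b b' : tens a (c *: b + b') = c *: tens a b + tens a b'.
Proof. by rewrite !tensE -clZ -clD; apply/clP/bilinear_relr. Qed.

Lemma tens_ind (P : T -> Prop) : P 0 ->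
  (forall c a b t, P t -> P (c *: tens a b + t)) -> forall t, P t.
Proof.
move=> P0 PD; apply: cl_ind; elim/malg_lin_ind => [|c [a b] g IH].
  by rewrite cl0.
by rewrite clD clZ -tensE; apply: PD.
Qed.

Section Lift.
Context (V : lmodType k) (f : A -> B -> V).

Hypothesis f_linl : forall b, linear (f^~ b).
Hypothesis f_linr : forall a, linear (f a).

Let tlift_cl g : tlift f (cl g) = mlift (fun x : A * B => f x.1 x.2) g.
Proof.
rewrite tlift.unlock; apply/eqP; rewrite -subr_eq0 -linearB /=; apply/eqP.
have : bilinear_rel (rp (cl g) - g) by apply/clP; rewrite rpK.
elim=> [|c p q _ IHp _ IHq|c a a' b|c a b b'].
- by rewrite linear0.
- by rewrite linearP /= IHp IHq scaler0 addr0.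
- by rewrite linearB linearP /= !mliftU /= f_linl subrr.
- by rewrite linearB linearP /= !mliftU /= f_linr subrr.
Qed.

Lemma tliftE a b : tlift f (tens a b) = f a b.
Proof. by rewrite tensE tlift_cl mliftU. Qed.

Lemma tlift_linear : linear (tlift f).
Proof.
move=> c; elim/cl_ind => p; elim/cl_ind => q.
by rewrite -clZ -clD !tlift_cl linearP.
Qed.

End Lift.

Lemma linear_comb (V W : lmodType k) (c : k) (F G : V -> W) :
  linear F -> linear G -> linear (fun v => c *: F v + G v).
Proof.
move=> lF lG d u v; rewrite lF lG !scalerDr !scalerA [d * c]mulrC -!addrA.
by congr (_ + _); rewrite addrCA.
Qed.

Lemma tens_ext (V : lmodType k) (F G : T -> V) : linear F -> linear G ->
  (forall a b, F (tens a b) = G (tens a b)) -> F =1 G.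
Proof.
move=> linF linG FG.
have H0 (H : T -> V) : linear H -> H 0 = 0.
  by move=> /(_ (-1) 0 0); rewrite scaler0 addr0 scaleN1r addNr.
elim/tens_ind => [|c a b t IH]; first by rewrite !H0.
by rewrite linF linG FG IH.
Qed.

End TensorModule.

(* See tensM. *)
HB.lock Definition tensor_mul (k : fieldType) (A B : algType k)
    (t u : tensor A B) : tensor A B :=
  tlift (fun a b => tlift (fun a' b' => tens (a * a') (b * b')) u) t.

HB.lock Definition tensor_hcomp (k : fieldType) (A B : grAlgType k) (d : nat) :
    tensor A B -> tensor A B :=
  tlift (fun a b => tens (hcomp d a) (hcomp d b)).

Section TensorAlgebra.
Context (k : fieldType) (A B : grAlgType k).
Local Notation T := (tensor A B).
Implicit Types (a : A) (b : B) (s t u : T).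

Let inner_linl a b b' : linear (fun a' => tens (a * a') (b * b')).
Proof. by move=> c x y; rewrite mulrDr -scalerAr tensPl. Qed.
Let inner_linr a b a' : linear (fun b' => tens (a * a') (b * b')).
Proof. by move=> c x y; rewrite mulrDr -scalerAr tensPr. Qed.
Let inner_lin a b : linear 
  (tlift (fun a' b' => tens (a * a') (b * b')) : T -> T).
Proof. by apply: tlift_linear => ?; [apply: inner_linl|apply: inner_linr]. Qed.
Let innerE a b a' b' :
  tlift (fun a' b' => tens (a * a') (b * b')) (tens a' b') =
  tens (a * a') (b * b').
Proof. by apply: tliftE => ?; [apply: inner_linl|apply: inner_linr]. Qed.

Let outer_linl u b :
  linear (fun a => tlift (fun a' b' => tens (a * a') (b * b')) u).
Proof.
move=> c x y; apply: (tens_ext (F := tlift _)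
  (G := fun u => c *: tlift _ u + tlift _ u)) => [||a' b'].
- exact: inner_lin.
- by apply: linear_comb; apply: inner_lin.
- by rewrite !innerE mulrDl -scalerAl tensPl.
Qed.

Let outer_linr u a :
  linear (fun b => tlift (fun a' b' => tens (a * a') (b * b')) u).
Proof.
move=> c x y; apply: (tens_ext (F := tlift _)
  (G := fun u => c *: tlift _ u + tlift _ u)) => [||a' b'].
- exact: inner_lin.
- by apply: linear_comb; apply: inner_lin.
- by rewrite !innerE mulrDl -scalerAl tensPr.
Qed.

Let mul_linl u : linear ((@tensor_mul k A B)^~ u).
Proof.
by rewrite tensor_mul.unlock;
  apply: tlift_linear => ?; [apply: outer_linl|apply: outer_linr].
Qed.

Let mul_tensl a b u : tensor_mul (tens a b) u =
  tlift (fun a' b' => tens (a * a') (b * b')) u.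
Proof.
by rewrite tensor_mul.unlock;
  apply: tliftE => ?; [apply: outer_linl|apply: outer_linr].
Qed.

Let mul_tens a b a' b' :
  tensor_mul (tens a b) (tens a' b') = tens (a * a') (b * b').
Proof. by rewrite mul_tensl innerE. Qed.

Let mul_linr t : linear (tensor_mul t).
Proof.
move=> c u v.
suff E : (@tensor_mul k A B)^~ (c *: u + v) =1
  (fun s => c *: tensor_mul s u + tensor_mul s v) by exact: E.
apply: tens_ext => [||a b].
- exact: mul_linl.
- by apply: linear_comb; apply: mul_linl.
- by rewrite !mul_tensl inner_lin.
Qed.

Let mul0 t : tensor_mul t 0 = 0.
Proof.
by have := mul_linr t (-1) 0 0; rewrite scaler0 addr0 scaleN1r addNr.
Qed.
Let mul0l t : tensor_mul 0 t = 0.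
Proof.
by have := mul_linl t (-1) 0 0; rewrite scaler0 addr0 scaleN1r addNr.
Qed.

Let mul_scalel c t u : c *: tensor_mul t u = tensor_mul (c *: t) u.
Proof. by rewrite -[in RHS](addr0 (c *: t)) mul_linl mul0l addr0. Qed.
Let mul_scaler c t u : c *: tensor_mul t u = tensor_mul t (c *: u).
Proof. by rewrite -[in RHS](addr0 (c *: u)) mul_linr mul0 addr0. Qed.

Fact tensor_mulA : associative (@tensor_mul k A B).
Proof.
move=> + + u; elim/tens_ind => [|c a b s IHs] t; first by rewrite !mul0l.
rewrite mul_linl (mul_linl t) (mul_linl u) IHs.
suff -> : tensor_mul (tens a b) (tensor_mul t u) =
  tensor_mul (tensor_mul (tens a b) t) u by [].
elim/tens_ind: t {s IHs} => [|d a' b' t IHt]; first by rewrite !(mul0l, mul0).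
rewrite mul_linl (mul_linr (tens a b)) (mul_linr (tens a b)) mul_linl IHt.
suff -> : tensor_mul (tens a b) (tensor_mul (tens a' b') u) =
  tensor_mul (tensor_mul (tens a b) (tens a' b')) u by [].
rewrite mul_tens; elim/tens_ind: u {t IHt} => [|e a2 b2 u IHu].
  by rewrite !mul0.
rewrite (mul_linr (tens a' b')) (mul_linr (tens a b)).
by rewrite (mul_linr (tens (a * a') (b * b'))) IHu !mul_tens !mulrA.
Qed.
Fact tensor_mul1l : left_id (tens 1 1) (@tensor_mul k A B).
Proof.
elim/tens_ind => [|c a b s IHs]; first by rewrite mul0.
by rewrite mul_linr IHs mul_tens !mul1r.
Qed.
Fact tensor_mul1r : right_id (tens 1 1) (@tensor_mul k A B).
Proof.
elim/tens_ind => [|c a b s IHs]; first by rewrite mul0l.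
by rewrite mul_linl IHs mul_tens !mulr1.
Qed.
Fact tensor_mulDl : left_distributive (@tensor_mul k A B) +%R.
Proof. by move=> s t u; have := mul_linl u 1 s t; rewrite !scale1r. Qed.
Fact tensor_mulDr : right_distributive (@tensor_mul k A B) +%R.
Proof. by move=> s t u; have := mul_linr s 1 t u; rewrite !scale1r. Qed.
Fact tensor_1_neq0 : tens 1 1 != 0 :> T.
Proof.
pose f a b : k^o := aug a * aug b.
have linl b : linear (f^~ b).
  by move=> c x y; rewrite /f aug_is_linear mulrDl -mulrA.
have linr a : linear (f a).
  by move=> c x y; rewrite /f aug_is_linear mulrDr mulrCA.
apply/eqP => /(congr1 (tlift f)); rewrite tliftE // /f !aug1 mulr1.
have := tlift_linear linl linr (-1) 0 0.
by rewrite scaler0 addr0 scaleN1r addNr => -> /eqP; rewrite oner_eq0.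
Qed.

HB.instance Definition _ := GRing.Zmodule_isNzRing.Build T
  tensor_mulA tensor_mul1l tensor_mul1r tensor_mulDl tensor_mulDr tensor_1_neq0.

Fact tensor_scaleAl (c : k) t u : c *: (t * u) = c *: t * u.
Proof. exact: mul_scalel. Qed.
HB.instance Definition _ := GRing.Lmodule_isLalgebra.Build k T tensor_scaleAl.

Fact tensor_scaleAr (c : k) t u : c *: (t * u) = t * (c *: u).
Proof. exact: mul_scaler. Qed.
HB.instance Definition _ := GRing.Lalgebra_isAlgebra.Build k T tensor_scaleAr.

Lemma tensM a b a' b' : tens a b * tens a' b' = tens (a * a') (b * b').
Proof. exact: mul_tens. Qed.

Lemma tens1 : tens 1 1 = 1 :> T. Proof. by []. Qed.

Let hc_linl d b : linear (fun a => tens (hcomp d a) (hcomp d b)).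
Proof. by move=> c x y; rewrite linearP tensPl. Qed.
Let hc_linr d a : linear (fun b => tens (hcomp d a) (hcomp d b)).
Proof. by move=> c x y; rewrite linearP tensPr. Qed.

Lemma tensor_hcomp_linear d : linear (@tensor_hcomp k A B d).
Proof.
by rewrite tensor_hcomp.unlock;
  apply: tlift_linear => ?; [apply: hc_linl|apply: hc_linr].
Qed.

Lemma tensor_hcomp_tens d a b :
  tensor_hcomp d (tens a b) = tens (hcomp d a) (hcomp d b).
Proof.
by rewrite tensor_hcomp.unlock;
  apply: tliftE => ?; [apply: hc_linl|apply: hc_linr].
Qed.

HB.instance Definition _ d := GRing.isLinear.Build k T T *:%R
  (@tensor_hcomp k A B d)
  (tensor_hcomp_linear d).

Lemma tens0l b : tens 0 b = 0 :> T.
Proof.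
by have := tensPl (-1) (0 : A) 0 b; rewrite scaler0 addr0 scaleN1r addNr.
Qed.

Lemma tens0r a : tens a 0 = 0 :> T.
Proof.
by have := tensPr (-1) a (0 : B) 0; rewrite scaler0 addr0 scaleN1r addNr.
Qed.

Lemma tensZl (c : k) a b : tens (c *: a) b = c *: tens a b.
Proof.
by have := tensPl c a 0 b; rewrite tens0l (addr0 (c *: a)) => ->; apply: addr0.
Qed.

Lemma tensZr (c : k) a b : tens a (c *: b) = c *: tens a b.
Proof.
by have := tensPr c a b 0; rewrite tens0r (addr0 (c *: b)) => ->; apply: addr0.
Qed.

End TensorAlgebra.

(* The span of the pure tensors a \otimes b with a and b of equal degree, that
   is \bigoplus_d A_d \otimes B_d. *)
Inductive segre_rel {k : fieldType} {A B : grAlgType k} : tensor A B -> Prop :=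
| segre_rel0 : segre_rel 0
| segre_relD t u : segre_rel t -> segre_rel u -> segre_rel (t + u)
| segre_rel_tens d a b :
    homogeneous d a -> homogeneous d b -> segre_rel (tens a b).

Section SegreProduct.
Context (k : fieldType) (A B : grAlgType k).
Local Notation T := (tensor A B).
Implicit Types (a : A) (b : B) (t u : T).

Definition segre_pred : {pred T} := fun t => `[< segre_rel t >].

Lemma segre_predP t : reflect (segre_rel t) (t \in segre_pred).
Proof. exact: asboolP. Qed.

Let segreZ (c : k) t : segre_rel t -> segre_rel (c *: t).
Proof.
elim=> [|u v _ IHu _ IHv|d a b ha hb]; first by rewrite scaler0; constructor.
  by rewrite scalerDr; constructor.
rewrite -tensZl; apply: (@segre_rel_tens _ _ _ d) => //.
by rewrite /homogeneous linearZ /= ha.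
Qed.

Let segreM t u : segre_rel t -> segre_rel u -> segre_rel (t * u).
Proof.
move=> st su; elim: st => [|v w _ IHv _ IHw|d a b ha hb].
- by rewrite mul0r; constructor.
- by rewrite mulrDl; constructor.
elim: su => [|v w _ IHv _ IHw|e a' b' ha' hb'].
- by rewrite mulr0; constructor.
- by rewrite mulrDr; constructor.
rewrite tensM; apply: (@segre_rel_tens _ _ _ (d + e)%N).
  exact: homogeneousM.
exact: homogeneousM.
Qed.

Fact segre_subalg_closed : subalg_closed segre_pred.
Proof.
split=> [|c t u /segre_predP st /segre_predP su|
  t u /segre_predP st /segre_predP su].
- by apply/segre_predP/(@segre_rel_tens _ _ _ 0%N); apply: hcomp1.
- by apply/segre_predP/segre_relD => //; apply: segreZ.
- exact/segre_predP/segreM.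
Qed.

HB.instance Definition _ :=
  GRing.isSubalgClosed.Build k T segre_pred segre_subalg_closed.

Record segre : Type := Segre { segre_val : T; _ : segre_val \in segre_pred }.

HB.instance Definition _ := [isSub for segre_val].
HB.instance Definition _ := [Choice of segre by <:].
HB.instance Definition _ := [SubChoice_isSubAlgebra of segre by <:].

Let th_linear d (c : k) t u :
  tensor_hcomp d (c *: t + u) = c *: tensor_hcomp d t + tensor_hcomp d u.
Proof. exact: tensor_hcomp_linear. Qed.

Let th0 d : tensor_hcomp d (0 : T) = 0.
Proof. exact: linear0. Qed.

Let thD d t u : tensor_hcomp d (t + u) = tensor_hcomp d t + tensor_hcomp d u.
Proof. exact: linearD. Qed.

Lemma tensor_hcomp_segre d t : tensor_hcomp d t \in segre_pred.
Proof.
elim/tens_ind: t => [|c a b t IH]; first by rewrite th0 rpred0.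
rewrite th_linear tensor_hcomp_tens rpredD ?rpredZ //.
by apply/segre_predP/(@segre_rel_tens _ _ _ d);
  rewrite /homogeneous hcompK eqxx.
Qed.

Definition segre_hcomp (d : nat) (s : segre) : segre :=
  Segre (tensor_hcomp_segre d (val s)).

Fact segre_hcomp_linear d : linear (segre_hcomp d).
Proof. by move=> c s t; apply: val_inj; apply: th_linear. Qed.

Fact segre_hcompK d e s : segre_hcomp d (segre_hcomp e s) =
  if d == e then segre_hcomp e s else 0.
Proof.
apply: val_inj; rewrite (fun_if val) /=.
elim/tens_ind: (segre_val s) => [|c a b t IH].
  by rewrite !th0 if_same.
rewrite (th_linear e) (th_linear d) IH (tensor_hcomp_tens e).
rewrite (tensor_hcomp_tens d) !hcompK.
by case: eqP => _ //; rewrite tens0l scaler0 addr0.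
Qed.

Fact segre_hcomp_sum s : exists N, s = \sum_(d < N) segre_hcomp d s.
Proof.
case: s => t st.
suff [N /(_ N (leqnn N)) tE] : exists N, forall M, (N <= M)%N ->
    t = \sum_(d < M) tensor_hcomp d t.
  by exists N; apply: val_inj; rewrite raddf_sum.
move/segre_predP: st; elim=> [|u v _ [N IHu] _ [N' IHv]|d a b ha hb].
- by exists 0%N => M _; rewrite big1 // => d _; apply: th0.
- exists (maxn N N') => M; rewrite geq_max => /andP[leN leN'].
  rewrite {1}(IHu M leN) {1}(IHv M leN') -big_split.
  by apply: eq_bigr => d _; rewrite thD.
exists d.+1 => M ltdM; rewrite (bigD1 (Ordinal ltdM)) //=.
rewrite tensor_hcomp_tens ha hb big1 ?addr0 // => e neq.
rewrite tensor_hcomp_tens -ha hcompK; case: eqP => [eE|_]; last exact: tens0l.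
by case/eqP: neq; apply: val_inj.
Qed.

Lemma tensor_hcompM d e t u :
  tensor_hcomp (d + e)%N (tensor_hcomp d t * tensor_hcomp e u) =
  tensor_hcomp d t * tensor_hcomp e u.
Proof.
elim/tens_ind: t => [|c a b t IH]; first by rewrite th0 mul0r th0.
rewrite th_linear mulrDl -scalerAl th_linear IH.
suff -> : tensor_hcomp (d + e)%N (tensor_hcomp d (tens a b) * tensor_hcomp e u)
  = tensor_hcomp d (tens a b) * tensor_hcomp e u by [].
elim/tens_ind: u {t IH} => [|c' a' b' u IH]; first by rewrite th0 mulr0 th0.
rewrite th_linear mulrDr -scalerAr th_linear IH.
suff -> : tensor_hcomp (d + e)%N
    (tensor_hcomp d (tens a b) * tensor_hcomp e (tens a' b'))
  = tensor_hcomp d (tens a b) * tensor_hcomp e (tens a' b') by [].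
rewrite (tensor_hcomp_tens d) (tensor_hcomp_tens e) tensM tensor_hcomp_tens.
by rewrite !hcompM.
Qed.

Fact segre_hcompM d e (x y : segre) :
  segre_hcomp (d + e)%N (segre_hcomp d x * segre_hcomp e y) =
  segre_hcomp d x * segre_hcomp e y.
Proof. by apply: val_inj; apply: tensor_hcompM. Qed.

Fact segre_hcomp1 : segre_hcomp 0 1 = 1.
Proof.
apply: val_inj; rewrite -[RHS]/(tens 1 1).
by apply: etrans (tensor_hcomp_tens 0 1 1) _; rewrite !hcomp1.
Qed.

Fact segre_hcomp0 s : exists c, segre_hcomp 0 s = c%:A.
Proof.
suff [c sE] : exists c, tensor_hcomp 0 (val s) = c%:A.
  by exists c; apply: val_inj.
elim/tens_ind: (val s) => [|c a b t [d IH]].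
  by exists 0; rewrite th0 scale0r.
have [ca aE] := hcomp0_scalar a; have [cb bE] := hcomp0_scalar b.
exists (c * (ca * cb) + d).
rewrite th_linear IH tensor_hcomp_tens aE bE tensZl tensZr tens1.
by rewrite (scalerDl 1 (c * _)) -(scalerA c) -(scalerA ca).
Qed.

HB.instance Definition _ := isGraded.Build k segre segre_hcomp_linear
  segre_hcompK segre_hcomp_sum segre_hcompM segre_hcomp1 segre_hcomp0.

Fact segre_tens_subproof d a b :
  homogeneous d a -> homogeneous d b -> tens a b \in segre_pred.
Proof. by move=> ha hb; apply/segre_predP/(@segre_rel_tens _ _ _ d). Qed.

Definition segre_tens d a b (ha : homogeneous d a) (hb : homogeneous d b) :
  segre := Segre (segre_tens_subproof ha hb).

End SegreProduct.

Local Open Scope classical_set_scope.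

(* A = k<W>/I, the letter z standing for w z. *)
Definition presentation {k : fieldType} {W : choiceType} {A : algType k}
    (w : W -> A) (I : set (free_alg k W)) : Prop :=
  exists phi : {lrmorphism free_alg k W -> A},
    [/\ forall z, phi (var k z) = w z,
        forall a, exists p, phi p = a &
        forall p, phi p = 0 <-> I p].

Section GroebnerBases.
Context {k : fieldType} {disp : Order.disp_t} {W : orderType disp}.
Implicit Types (u v : {fmonom W}) (p : free_alg k W).
Implicit Types (G I : set (free_alg k W)).

Definition deglex u v : bool :=
  (fdeg u < fdeg v)%N ||
  (fdeg u == fdeg v) && ((u : seqlexi W) < (v : seqlexi W))%O.

Definition leading_monomial p u : Prop :=
  u \in msupp p /\ forall v, v \in msupp p -> v != u -> deglex v u.

Definition monic p : Prop := exists2 u, leading_monomial p u & p@_u = 1.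

(* The elements of a Groebner basis are normalized to be monic; in particular
   they are nonzero. *)
Definition groebner_basis G I : Prop :=
  [/\ forall g, G g -> monic g,
      ideal_gen G = I &
      forall p v, I p -> leading_monomial p v ->
        exists g u, [/\ G g, leading_monomial g u & infix u v]].

Definition reduced_groebner_basis G I : Prop :=
  [/\ groebner_basis G I,
      forall g, G g -> ~ groebner_basis (G `\ g) I &
      forall g, G g -> forall v, v \in msupp g ->
        forall h u, (G `\ g) h -> leading_monomial h u -> ~~ infix u v].

Definition PBW_algebra {A : algType k} (w : W -> A) : Prop :=
  exists I G, [/\ presentation w I, groebner_basis G I &
                  forall g, G g -> homogeneous 2 g].

End GroebnerBases.

Lemma var_homogeneous (k : fieldType) (Z : choiceType) (z : Z) :
  homogeneous 1 (var k z).
Proof.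
by apply: etrans (free_hcomp_word k 1 (fmu z)) _; rewrite fdegU eqxx.
Qed.

Lemma varM_homogeneous (k : fieldType) (Z : choiceType) (x y : Z) :
  homogeneous 2 (var k x * var k y).
Proof.
exact: (@homogeneousM _ _ 1%N 1%N (var k x) (var k y)
  (var_homogeneous k x) (var_homogeneous k y)).
Qed.

Section YangBaxterAlgebra.
Context (k : fieldType) (Z : choiceType) (r : Z * Z -> Z * Z).

(* xy - x'y' whenever r (x, y) = (x', y'); for r = perm_solution g these are the
   relations xy - g(y)y. *)
Definition yb_relations : set (free_alg k Z) :=
  [set var k x.1 * var k x.2 - var k (r x).1 * var k (r x).2 | x in setT].

Fact yb_relations_homogeneous p :
  yb_relations p -> exists2 d, (0 < d)%N & homogeneous d p.
Proof.
move=> [x _ <-]; exists 2%N => //.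
by apply: homogeneousB; apply: varM_homogeneous.
Qed.

Definition yb_relators : relators (free_alg k Z) :=
  Relators yb_relations_homogeneous.

Definition yb_gen (z : Z) : quot_alg yb_relators :=
  quot_pi yb_relators (var k z).

Lemma yb_gen_homogeneous z : homogeneous 1 (yb_gen z).
Proof.
apply: etrans (quot_hcompE yb_relators 1 (var k z)) _.
by congr quot_pi; apply: var_homogeneous.
Qed.

End YangBaxterAlgebra.

Notation yb_algebra k r := (quot_alg (yb_relators k r)).

Definition perm_solution (Z : finType) (g : {perm Z}) : Z * Z -> Z * Z :=
  fun z => (g z.2, z.2).

Definition cartesian_solution (X Y : Type)
    (r : X * X -> X * X) (s : Y * Y -> Y * Y) :
    (X * Y) * (X * Y) -> (X * Y) * (X * Y) :=
  fun z => (((r (z.1.1, z.2.1)).1, (s (z.1.2, z.2.2)).1),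
            ((r (z.1.1, z.2.1)).2, (s (z.1.2, z.2.2)).2)).

Definition circ (k : fieldType) (X Y : choiceType)
    (r : X * X -> X * X) (s : Y * Y -> Y * Y) (w : X * Y) :
    segre (yb_algebra k r) (yb_algebra k s) :=
  segre_tens (yb_gen_homogeneous k r w.1) (yb_gen_homogeneous k s w.2).

Section SegreRelations.
Context (k : fieldType) (W : choiceType).
Implicit Types (p q o : W).

(* With o = w_11, p = w_jb and q = w_ia, this is F_{jb,ia}. *)
Definition F_rel o p q : free_alg k W := var k p * var k q - var k o * var k q.

Definition Re_red o : set (free_alg k W) :=
  [set F_rel o pq.1 pq.2 | pq in [set pq : W * W | pq.1 != o]].

Definition f_rel (Psi : W -> W) p q : free_alg k W :=
  var k p * var k q - var k (Psi q) * var k q.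

Definition Re_segre (Psi : W -> W) : set (free_alg k W) :=
  [set f_rel Psi pq.1 pq.2 | pq in setT].

End SegreRelations.

Arguments Re_red k {W} o.
Arguments Re_segre k {W} Psi.

(* Main.v *)
Require Import Defs.
From HB Require Import structures.
From mathcomp Require Import all_boot all_order all_algebra.
From mathcomp Require Import boolp classical_sets cardinality.
From mathcomp Require Import perm finmap monalg.

Set Implicit Arguments.
Unset Strict Implicit.
Unset Printing Implicit Defensive.

Import Order.TTheory GRing.Theory.
Local Open Scope ring_scope.
Local Open Scope classical_set_scope.
Local Open Scope card_scope.

(** In the Yang-Baxter algebra of a permutation idempotent solution on Z the
    relations x z = g(z) z say, for every z, that all products x z with last
    letter z agree.  The permutation g disappears: with any letter o, the ideal
    is the same as the one of the relations x z = o z, and two words are equal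
    in the quotient as soon as they have the same length and the same last
    letter.  Thus the ideal is the kernel of the linear map [reduce o], which
    sends a word to o...oz with z its last letter ([ideal_gen_ker_reduce]).

    Every ideal of the theorem is of this kind, and hence a kernel of [reduce]:
    the ideals of [Re_red], of [Re_segre] and of the Yang-Baxter algebra of the
    Cartesian product, all over the alphabet X * Y.  This settles the second
    set of generators.

    The Segre product has the same kernel.  The homomorphism from the free
    algebra on X * Y that sends a letter to its [circ] maps a word u to the
    tensor of the words of first and of second components of u.  It is onto,
    as two words of equal length can be zipped ([circ_lift_surj]).  Normal forms
    are computed componentwise, so the product of a normal form coefficient in
    A with one in B is a functional that recovers a coefficient of the normal
    form over X * Y from the image in the tensor product
    ([reduce_circ_lift]); hence the kernel is the kernel of [reduce].  This
    gives the presentation, and, by comparing two graded quotients with the same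
    kernel ([same_kernel_isomorphic]), the isomorphism with the Yang-Baxter
    algebra of the Cartesian product.

    If o is the least letter, then o...oz is the least of the words of its
    length that end in z.  An element h of the kernel whose leading monomial v
    is of this form would have no other word with normal form v in its support,
    so that v could not cancel in [reduce o h].  Hence v has a letter p <> o
    before its last letter, and contains the leading monomial of a relation
    p q = o q ([Re_red_groebner]). *)

(** * The free algebra *)

Section FreeLift.
Context (k : fieldType) (Z : choiceType) (A : algType k) (w : Z -> A).
Local Notation F := (free_alg k Z).

Definition free_lift (p : F) : A :=
  mlift (fun u : {fmonom Z} => \prod_(x <- u) w x) p.

Fact free_lift_linear : linear free_lift.
Proof. exact: mlift_is_linear. Qed.
HB.instance Definition _ := GRing.isLinear.Build k F A *:%R
  free_lift free_lift_linear.

Lemma free_lift_word u : free_lift (word k u) = \prod_(x <- u) w x.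
Proof. exact: mliftU. Qed.

Fact free_lift_monoid_morphism : monoid_morphism free_lift.
Proof.
split=> [|p q]; first by rewrite -word1 free_lift_word fm1 big_nil.
elim/free_ind: p => [|c u p IHp]; first by rewrite mul0r linear0 mul0r.
rewrite mulrDl -scalerAl !free_lift_linear mulrDl -scalerAl.
congr (_ *: _ + _); last exact: IHp.
elim/free_ind: q {p IHp} => [|d v q IHq]; first by rewrite mulr0 linear0 mulr0.
rewrite mulrDr -scalerAr !free_lift_linear mulrDr -scalerAr.
congr (_ *: _ + _); last exact: IHq.
by rewrite wordM !free_lift_word fmM big_cat.
Qed.
HB.instance Definition _ := GRing.isMonoidMorphism.Build F A
  free_lift free_lift_monoid_morphism.

Lemma free_lift_var z : free_lift (var k z) = w z.
Proof. by rewrite free_lift_word fmU big_seq1. Qed.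

End FreeLift.

Section FreeWords.
Context (k : fieldType) (Z : choiceType).
Implicit Types (u v : {fmonom Z}) (x y : Z) (r t : seq Z).

Lemma var_mul x y : var k x * var k y = word k (fmmul (fmu x) (fmu y)).
Proof. exact: wordM. Qed.

Lemma word_mul_rel u x y z v :
  word k u * (var k x * var k z - var k y * var k z) * word k v =
  word k (FMonom (u ++ x :: z :: v)) - word k (FMonom (u ++ y :: z :: v)).
Proof.
have E q : word k u * (var k q * var k z) * word k v =
    word k (FMonom (u ++ q :: z :: v)).
  rewrite var_mul (wordM k u) (wordM k (fmmul _ _)); congr word; apply: val_inj.
  by rewrite !(fmmulE, fmuE) /= -catA.
have mulBm (R : pzRingType) (a b c d : R) :
    a * (b - c) * d = a * b * d - a * c * d.
  by rewrite mulrBr mulrBl.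
by apply: etrans (mulBm _ _ _ _ _) _; congr (_ - _); apply: E.
Qed.

Lemma mcoeff_word u v : (word k u)@_v = (u == v)%:R.
Proof. exact: mcoeffU. Qed.

(** By bilinearity the cofactors of a relation may be taken to be words. *)
Lemma ideal_gen_words (V : lmodType k) (L : free_alg k Z -> V)
    (S : set (free_alg k Z)) : linear L ->
  (forall s u v, S s -> L (word k u * s * word k v) = 0) ->
  forall p, ideal_gen S p -> L p = 0.
Proof.
move=> linL LS p.
have L0 : L 0 = 0.
  by have := linL (-1) 0 0; rewrite scaler0 addr0 scaleN1r addNr.
have LD c f g : L f = 0 -> L g = 0 -> L (c *: f + g) = 0.
  by move=> Lf Lg; rewrite linL Lf Lg scaler0 addr0.
elim=> [//|q r _ IHq _ IHr|a s b Ss].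
  by rewrite -[q]scale1r; apply: LD.
elim/free_ind: a => [|c u a IHa]; first by rewrite !mul0r.
have -> : (c *: word k u + a) * s * b = c *: (word k u * s * b) + a * s * b.
  by rewrite !mulrDl -!scalerAl.
apply: (LD); last exact: IHa.
elim/free_ind: b {IHa} => [|d v b IHb]; first by rewrite mulr0.
have -> : word k u * s * (d *: word k v + b) =
  d *: (word k u * s * word k v) + word k u * s * b.
  by rewrite mulrDr -scalerAr.
by apply: LD; [apply: LS|apply: IHb].
Qed.

Lemma word_inj : injective (@word k Z).
Proof.
move=> u v /(congr1 (mcoeff v)); rewrite !mcoeff_word eqxx.
by case: eqP => // _ /eqP; rewrite eq_sym oner_eq0.
Qed.

End FreeWords.

(** * Normal forms of words *)

(** The normal form of words modulo the relations [x z = o z]: only the length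
    and the last letter survive. *)
Fixpoint last_letter_nf (T : Type) (o : T) (s : seq T) : seq T :=
  if s is x :: s' then
    (if s' is [::] then [:: x] else o :: last_letter_nf o s')
  else [::].

Section NormalForm.
Context (T : Type) (o : T).
Local Notation nf := (last_letter_nf o).

Lemma size_nf s : size (nf s) = size s.
Proof. by elim: s => //= x [|y s] //= ->. Qed.

Lemma map_nf (U : Type) (g : T -> U) s :
  map g (nf s) = last_letter_nf (g o) (map g s).
Proof. by elim: s => //= x [|y s] //= ->. Qed.

Lemma nf_cat s t : ~~ nilp t -> nf (s ++ t) = nseq (size s) o ++ nf t.
Proof.
move=> t0; elim: s => //= x s IH; rewrite -IH.
by case: s {IH} => // ; case: t t0.
Qed.

Lemma nf_replace s p q t r : nf (s ++ p :: r :: t) = nf (s ++ q :: r :: t).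
Proof. by rewrite !nf_cat. Qed.

End NormalForm.

Lemma nf_neqP (T : eqType) (o : T) s : last_letter_nf o s != s ->
  exists p q, p != o /\ infix [:: p; q] s.
Proof.
elim: s => //= x [|y s] IH //=; first by rewrite eqxx.
rewrite eqseq_cons negb_and; have [<-|ox _] := eqVneq o x.
  move=> /IH [p [q [po pq]]]; exists p, q; split=> //.
  exact: infix_trans pq (infix_cons _ _).
exists x, y; rewrite eq_sym; split=> //.
by rewrite !eqxx prefix0s.
Qed.

(** The lexicographic order of words of one length first compares the letters
    that [last_letter_nf] replaces by the least one. *)
Lemma nf_le (d : Order.disp_t) (W : orderType d) (o : W) (s : seq W) :
  (forall x, o <= x)%O ->
  ((last_letter_nf o s : seqlexi W) <= (s : seqlexi W))%O.
Proof.
move=> o_min; elim: s => //= x [|y s] IH //.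
by rewrite lexi_cons o_min; apply/implyP => _.
Qed.

Section Reduce.
Context (k : fieldType) (Z : choiceType) (o : Z).
Local Notation F := (free_alg k Z).
Implicit Types (u v : {fmonom Z}) (p q : F).

Definition reduce p : F :=
  mlift (fun u : {fmonom Z} => word k (FMonom (last_letter_nf o u))) p.

Fact reduce_linear : linear reduce.
Proof. exact: mlift_is_linear. Qed.
HB.instance Definition _ := GRing.isLinear.Build k F F *:%R
  reduce reduce_linear.

Lemma reduce_word u : reduce (word k u) = word k (FMonom (last_letter_nf o u)).
Proof. exact: mliftU. Qed.

Lemma reduce_var z : reduce (var k z) = var k z.
Proof. by rewrite /var fmuE reduce_word. Qed.

(** Relations between products with equal second letter do not change lengths
    or last letters, so [reduce] kills the ideal.  Conversely, if they yield
    all the [x z = o z], the letters of a word turn into [o] one after the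
    other, from the left, up to the last. *)
Lemma ideal_gen_ker_reduce (S : set F) :
  (forall s, S s -> exists x y z, s = var k x * var k z - var k y * var k z) ->
  (forall x z, ideal_gen S (var k x * var k z - var k o * var k z)) ->
  forall p, ideal_gen S p <-> reduce p = 0.
Proof.
move=> Sform So p.
have sub_nf r s : ideal_gen S
    (word k (FMonom (r ++ s)) - word k (FMonom (r ++ last_letter_nf o s))).
  (* The prefix r collects the letters that are already replaced by o. *)
  elim: s r => [|x [|y s] IH] r; [by rewrite /= subrr; apply: ideal_gen0..|].
  rewrite -[_ - _](subrKA (word k (FMonom (r ++ o :: y :: s)))).
  apply: ideal_genD; last by have := IH (rcons r o); rewrite !cat_rcons.
  rewrite -(word_mul_rel k (FMonom r) x o y (FMonom s)).
  exact: ideal_genMM.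
split=> [|p0].
  apply: ideal_gen_words => [|s u v /Sform [x [y [z ->]]]].
    exact: reduce_linear.
  rewrite word_mul_rel linearB /= !reduce_word /= (nf_replace _ _ x y).
  exact: subrr.
rewrite -[p]subr0 -p0; elim/free_ind: p {p0} => [|c u p IH].
  by rewrite linear0 subrr; apply: ideal_gen0.
rewrite linearP /= opprD addrACA -scalerBr; apply: ideal_genD => //.
rewrite -mulr_algl -[_ * _]mulr1; apply: ideal_genMM.
by rewrite reduce_word; case: u => u; apply: (sub_nf [::]).
Qed.

End Reduce.

Section RelationIdeals.
Context (k : fieldType) (Z : choiceType) (o : Z).
Implicit Types p : free_alg k Z.

Lemma ideal_Re_redP p : ideal_gen (Re_red k o) p <-> reduce o p = 0.
Proof.
apply: ideal_gen_ker_reduce => [s [[x z] _ <-]|x z]; first by exists x, o, z.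
have [->|xo] := eqVneq x o; first by rewrite subrr; apply: ideal_gen0.
by apply: ideal_gen_sub; exists (x, z).
Qed.

Lemma ideal_Re_segreP (Psi : Z -> Z) p :
  ideal_gen (Re_segre k Psi) p <-> reduce o p = 0.
Proof.
apply: ideal_gen_ker_reduce => [s [[x z] _ <-]|x z].
  by exists x, (Psi z), z.
have rel y : ideal_gen (Re_segre k Psi) (f_rel k Psi y z).
  by apply: ideal_gen_sub; exists (y, z).
(* Both x z and o z are equal to Psi(z) z. *)
have -> : var k x * var k z - var k o * var k z =
    f_rel k Psi x z + (-1) * f_rel k Psi o z * 1.
  by rewrite mulN1r mulr1 /f_rel opprB addrA subrK.
by apply: ideal_genD; [|apply: ideal_genMM].
Qed.

Lemma ideal_ybP r (Psi : Z -> Z) : (forall x, r x = (Psi x.2, x.2)) ->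
  forall p, ideal_gen (@yb_relations k Z r) p <-> reduce o p = 0.
Proof.
move=> rE p; have -> : r = fun x => (Psi x.2, x.2) by apply: funext.
exact: (ideal_Re_segreP Psi).
Qed.

End RelationIdeals.

(** * The Groebner basis *)

Section LastLetterGroebner.
Context (k : fieldType) (disp : Order.disp_t) (W : orderType disp) (o : W).
Hypothesis o_min : forall x : W, (o <= x)%O.
Implicit Types (u v : {fmonom W}) (p q : W) (h : free_alg k W).
Local Notation nf u := (FMonom (last_letter_nf o u)).
Local Notation pair_word p q := (fmmul (fmu p) (fmu q)).

Lemma pair_wordE p q : pair_word p q = FMonom [:: p; q].
Proof. by apply: val_inj; rewrite fmmulE !fmuE. Qed.

Lemma deglex_asym u v : deglex u v -> ~~ deglex v u.
Proof.
rewrite /deglex negb_or => /orP[uv|/andP[/eqP -> uv]].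
  by rewrite -leqNgt (ltnW uv) (gtn_eqF uv).
by rewrite ltnn eqxx /= -leNgt ltW.
Qed.

Lemma leading_monomial_uniq h u v :
  leading_monomial h u -> leading_monomial h v -> u = v.
Proof.
move=> [hu lu] [hv lv]; have [//|uv] := eqVneq u v.
by have /deglex_asym := lv u hu uv; rewrite lu // eq_sym.
Qed.

Lemma nf_deglex u : nf u != u -> deglex (nf u) u.
Proof.
move=> neq; apply/orP; right; rewrite /fdeg /= size_nf eqxx /=.
rewrite lt_neqAle nf_le // andbT.
by apply: contraNN neq => /eqP E; apply/eqP/val_inj.
Qed.

Lemma F_rel_nf p q : F_rel k o p q =
  word k (pair_word p q) - word k (nf (pair_word p q)).
Proof. by rewrite /F_rel !var_mul !pair_wordE. Qed.

Lemma F_rel_coeff p q v : (F_rel k o p q)@_v =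
  (FMonom [:: p; q] == v)%:R - (FMonom [:: o; q] == v)%:R.
Proof. by rewrite F_rel_nf pair_wordE (mcoeffB v) !mcoeff_word. Qed.

Lemma F_rel_lead_coeff p q : p != o -> (F_rel k o p q)@_(FMonom [:: p; q]) = 1.
Proof.
move=> po; rewrite F_rel_coeff eqxx.
case: eqP => [[op]|_]; last by rewrite subr0.
by rewrite op eqxx in po.
Qed.

Lemma msupp_F_rel p q v : v \in msupp (F_rel k o p q) ->
  v = FMonom [:: p; q] \/ v = FMonom [:: o; q].
Proof.
rewrite -mcoeff_neq0 F_rel_coeff.
case: (FMonom [:: p; q] =P v) => [<-|_]; first by left.
by case: (_ =P v) => [<-|_]; [right|rewrite subrr eqxx].
Qed.

Lemma leading_F_rel p q : p != o ->
  leading_monomial (F_rel k o p q) (pair_word p q).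
Proof.
rewrite pair_wordE => po; split=> [|v /msupp_F_rel[->|->]]; last 2 first.
- by rewrite eqxx.
- by apply: (@nf_deglex (FMonom [:: p; q])).
by rewrite -mcoeff_neq0 F_rel_lead_coeff ?oner_neq0.
Qed.

Lemma F_rel_inj p q p' q' : p != o -> p' != o ->
  F_rel k o p q = F_rel k o p' q' -> p = p' /\ q = q'.
Proof.
move=> po po' E; have := leading_F_rel q po; rewrite E => lead.
have := leading_monomial_uniq lead (leading_F_rel q' po').
by rewrite !pair_wordE => -[] {E lead}.
Qed.

Lemma reduce_coeff h v :
  (reduce o h)@_v = \sum_(u <- msupp h) h@_u * (nf u == v)%:R.
Proof.
rewrite /reduce mlift.unlock raddf_sum; apply: eq_bigr => u _ /=.
by apply: etrans (mcoeffZ _ _ _) _; congr (_ * _); apply: mcoeff_word.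
Qed.

(** In the kernel of [reduce] no leading monomial [v] can be a normal form:
    every other word with normal form [v] lies above [v], so the coefficient of
    [v] could not cancel. *)
Lemma reduce_lead_neq0 h v : leading_monomial h v -> nf v = v ->
  reduce o h != 0.
Proof.
move=> [hv lead] vE; apply/negP => /eqP /(congr1 (mcoeff v)).
rewrite mcoeff0 reduce_coeff (big_fsetD1 v) //= vE eqxx mulr1.
rewrite big1_fset => [|u + _]; last first.
  rewrite in_fsetD1 => /andP[uv hu].
  case: eqP => [uE|_]; last exact: mulr0.
  have := lead u hu uv; rewrite -uE => /deglex_asym/negP[].
  by apply: nf_deglex; rewrite uE eq_sym.
by rewrite addr0 => /eqP; rewrite mcoeff_eq0 hv.
Qed.

Lemma Re_red_groebner : groebner_basis (Re_red k o) (ideal_gen (Re_red k o)).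
Proof.
split=> // [g [[p q] /= po <-]|h v Ih lead].
  exists (pair_word p q); first exact: leading_F_rel.
  by rewrite pair_wordE F_rel_lead_coeff.
have /nf_neqP [p [q [po pq]]] : last_letter_nf o v != v.
  apply: contraTneq (introT eqP (iffLR (ideal_Re_redP o h) Ih)) => vE.
  by apply: reduce_lead_neq0 lead _; apply: val_inj.
exists (F_rel k o p q), (pair_word p q); split.
- by exists (p, q).
- exact: leading_F_rel.
- by rewrite pair_wordE.
Qed.

Lemma infix_size (T : eqType) (s t : seq T) :
  infix s t -> size s = size t -> s = t.
Proof.
case/infixP => r [r' ->]; rewrite !size_cat => /eqP.
rewrite addnCA -{1}[size s]addn0 eqn_add2l eq_sym addn_eq0 => /andP[].
by move=> /nilP -> /nilP ->; rewrite cats0.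
Qed.

(** Distinct relations have distinct leading monomials, of the same length as
    all monomials that occur, and the trailing monomial [o q] is normal.  So no
    leading monomial occurs in another relation; hence the leading monomial of a
    relation that is left out is divisible by none of the others. *)
Lemma Re_red_reduced :
  reduced_groebner_basis (Re_red k o) (ideal_gen (Re_red k o)).
Proof.
have red g : Re_red k o g -> forall v, v \in msupp g ->
    forall h u, (Re_red k o `\ g) h -> leading_monomial h u -> ~~ infix u v.
  move=> [[p q] /= po <-] v /msupp_F_rel vE h u [[[p' q'] /= po' <-] neq] lead.
  rewrite (leading_monomial_uniq lead (leading_F_rel q' po')) pair_wordE /=.
  apply/negP => /infix_size; case: vE => -> /(_ erefl) [pE qE].
    by apply: neq; rewrite /= pE qE.
  by rewrite pE eqxx in po'.
split=> // [|g Gg [_ _ lead]]; first exact: Re_red_groebner.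
have [[p q] /= po gE] := Gg.
have lg : leading_monomial g (pair_word p q).
  by rewrite -gE; apply: leading_F_rel.
have [h [u [Gh lu /negP[]]]] := lead g _ (ideal_gen_sub Gg) lg.
exact: negP (red g Gg _ lg.1 h u Gh lu).
Qed.

End LastLetterGroebner.

(** * Graded homomorphisms and quotients *)

Section GradedLift.
Context (k : fieldType) (Z : choiceType) (A : grAlgType k) (w : Z -> A).
Hypothesis w_homogeneous : forall z, homogeneous 1 (w z).

Lemma homogeneous_prod s : homogeneous (size s) (\prod_(x <- s) w x).
Proof.
elim: s => [|x s IH]; first by rewrite big_nil; apply: hcomp1.
by rewrite big_cons; apply: (@homogeneousM _ _ 1%N).
Qed.

Lemma free_lift_hcomp d p : free_lift w (hcomp d p) = hcomp d (free_lift w p).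
Proof.
elim/free_ind: p => [|c u p IH]; first by rewrite !linear0.
have hL : free_lift w (hcomp d (word k u)) = hcomp d (free_lift w (word k u)).
  rewrite -[hcomp d (word k u)]/(free_hcomp d (word k u)) free_hcomp_word.
  rewrite free_lift_word -[X in hcomp d X]homogeneous_prod hcompK eq_sym.
  rewrite homogeneous_prod; case: eqP => _; last exact: linear0.
  exact: free_lift_word.
rewrite (hcomp_is_linear d c (word k u) p) !free_lift_linear hcomp_is_linear.
by congr (_ *: _ + _); [apply: hL|apply: IH].
Qed.

End GradedLift.

Section SameKernel.
Context (k : fieldType) (R A B : grAlgType k).
Context (alpha : {lrmorphism R -> A}) (beta : {lrmorphism R -> B}).
Hypothesis alpha_surj : forall a, exists p, alpha p = a.
Hypothesis beta_surj : forall b, exists p, beta p = b.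
Hypothesis same_ker : forall p, alpha p = 0 <-> beta p = 0.
Hypothesis alpha_graded : forall d p, alpha (hcomp d p) = hcomp d (alpha p).
Hypothesis beta_graded : forall d p, beta (hcomp d p) = hcomp d (beta p).

Definition induced_map (a : A) : B := beta (sval (cid (alpha_surj a))).

Lemma induced_mapE p : induced_map (alpha p) = beta p.
Proof.
rewrite /induced_map; case: cid => q /= qp; apply/eqP; rewrite -subr_eq0.
by rewrite -rmorphB; apply/eqP/same_ker; rewrite rmorphB /= qp subrr.
Qed.

Fact induced_map_linear : linear induced_map.
Proof.
move=> c a b; have [p <-] := alpha_surj a; have [q <-] := alpha_surj b.
by rewrite -linearP !induced_mapE linearP.
Qed.
HB.instance Definition _ := GRing.isLinear.Build k A B *:%R
  induced_map induced_map_linear.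

Fact induced_map_monoid_morphism : monoid_morphism induced_map.
Proof.
split=> [|a b]; first by rewrite -(rmorph1 alpha) induced_mapE rmorph1.
have [p <-] := alpha_surj a; have [q <-] := alpha_surj b.
by rewrite -rmorphM !induced_mapE rmorphM.
Qed.
HB.instance Definition _ := GRing.isMonoidMorphism.Build A B
  induced_map induced_map_monoid_morphism.

Lemma same_kernel_isomorphic : graded_isomorphic A B.
Proof.
exists (induced_map : {lrmorphism A -> B}); split=> [|d a] /=; last first.
  have [p <-] := alpha_surj a.
  by rewrite -alpha_graded !induced_mapE beta_graded.
pose inv b := alpha (sval (cid (beta_surj b))).
exists inv => [a|b]; last first.
  by rewrite /inv; case: cid => p /= <-; rewrite induced_mapE.
have [p <-] := alpha_surj a; rewrite induced_mapE /inv; case: cid => q /= qp.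
apply/eqP; rewrite -subr_eq0 -rmorphB; apply/eqP/same_ker.
by rewrite rmorphB /= qp subrr.
Qed.

End SameKernel.

(** * The Segre product *)

Section YangBaxterFunctionals.
Context (k : fieldType) (Z : choiceType) (o : Z).
Context (r : Z * Z -> Z * Z) (Psi : Z -> Z).
Hypothesis rE : forall x, r x = (Psi x.2, x.2).
Local Notation Q := (yb_algebra k r).
Local Notation pi := (quot_pi (yb_relators k r)).

Lemma yb_piP p q : pi p = pi q <-> reduce o p = reduce o q.
Proof.
apply: iff_trans (quot_piP _ _ _) _; apply: iff_trans (ideal_ybP o rE _) _.
rewrite linearB /=; split=> [/eqP|->]; last exact: subrr.
by rewrite subr_eq0 => /eqP.
Qed.

Lemma yb_gen_mul x y z :
  yb_gen k r x * yb_gen k r z = yb_gen k r y * yb_gen k r z.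
Proof.
rewrite /yb_gen -!quot_piM; apply/yb_piP; rewrite !var_mul !reduce_word.
by congr word; apply: val_inj; rewrite !fmmulE !fmuE.
Qed.

(** The coefficient of [v] in the normal form, as a functional on the quotient;
    well defined by [nf_coeff_pi]. *)
Definition nf_coeff (v : {fmonom Z}) (x : Q) : k^o :=
  (reduce o (quot_repr x))@_v.

Lemma nf_coeff_pi v p : nf_coeff v (pi p) = (reduce o p)@_v.
Proof. by congr mcoeff; apply/yb_piP; rewrite quot_reprK. Qed.

Lemma nf_coeff_linear v : linear (nf_coeff v).
Proof.
move=> c; elim/quot_ind => p; elim/quot_ind => q.
by rewrite -linearP !nf_coeff_pi linearP mcoeffD mcoeffZ.
Qed.

End YangBaxterFunctionals.

Section SegrePresentation.
Context (k : fieldType) (X Y : choiceType) (oX : X) (oY : Y).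
Context (r : X * X -> X * X) (f : X -> X) (s : Y * Y -> Y * Y) (g : Y -> Y).
Hypothesis rE : forall x, r x = (f x.2, x.2).
Hypothesis sE : forall y, s y = (g y.2, y.2).
Local Notation W := (X * Y)%type.
Local Notation AB := (segre (yb_algebra k r) (yb_algebra k s)).
Local Notation w := (circ k r s).
Local Notation o := (oX, oY).
Local Notation piX u :=
  (quot_pi (yb_relators k r) (word k (FMonom (map fst u)))).
Local Notation piY u :=
  (quot_pi (yb_relators k s) (word k (FMonom (map snd u)))).

Lemma circ_homogeneous z : homogeneous 1 (w z).
Proof.
apply: val_inj; apply: etrans (tensor_hcomp_tens 1 _ _) _.
by rewrite !yb_gen_homogeneous.
Qed.

Lemma circ_mul x y z : w x * w z = w y * w z.
Proof.
apply: val_inj; apply: etrans (tensM _ _ _ _) _.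
apply: etrans (esym (tensM _ _ _ _)).
by rewrite (yb_gen_mul k oX rE x.1 y.1) (yb_gen_mul k oY sE x.2 y.2).
Qed.

Lemma val_circ_lift (u : {fmonom W}) :
  val (free_lift w (word k u)) = tens (piX u) (piY u).
Proof.
rewrite free_lift_word; case: u => u /=; elim: u => [|x u IH].
  by rewrite big_nil /= -!fmoneE.
rewrite big_cons; apply: etrans (congr1 _ IH) _.
apply: etrans (tensM _ _ _ _) _.
by congr tens; apply: etrans (esym (quot_piM _ _ _)) _;
  rewrite wordM fmmulE fmuE.
Qed.

(** The Segre product is spanned by tensors of words of equal length, and such a
    pair of words is the image of its zip. *)
Lemma circ_lift_surj (a : AB) : exists p, free_lift w p = a.
Proof.
pose im t := exists p, val (free_lift w p) = t.
have imD c t t' : im t -> im t' -> im (c *: t + t').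
  by move=> [p <-] [q <-]; exists (c *: p + q); rewrite free_lift_linear.
have im0 : im 0 by exists 0; rewrite linear0.
suff [p pE] : im (val a) by exists p; apply: val_inj.
case: a => t /= /segre_predP; elim=> {t} [//|t t' _ IHt _ IHt'|d a b <- <-].
  by rewrite -[t]scale1r; apply: (imD).
elim/quot_ind: a => p; elim/quot_ind: b => q.
rewrite -![hcomp d _]/(quot_hcomp d _) !quot_hcompE.
elim/free_ind: p => [|c u p IHp]; first by rewrite !linear0 tens0l.
rewrite (hcomp_is_linear d c (word k u) p) linearP tensPl.
apply: (imD); last exact: IHp.
elim/free_ind: q {IHp} => [|c' v q IHq]; first by rewrite !linear0 tens0r.
rewrite (hcomp_is_linear d c' (word k v) q) linearP tensPr.
apply: (imD); last exact: IHq.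
rewrite -[hcomp d (word k u)]/(free_hcomp d (word k u)) free_hcomp_word.
rewrite -[hcomp d (word k v)]/(free_hcomp d (word k v)) free_hcomp_word.
case: eqP => [ud|_]; last by rewrite linear0 tens0l.
case: eqP => [vd|_]; last by rewrite linear0 tens0r.
have uv : size u = size v by rewrite -!fdegE ud vd.
exists (word k (FMonom (zip u v))); rewrite val_circ_lift.
by rewrite [map fst _]unzip1_zip ?uv // [map snd _]unzip2_zip ?uv // !fmK.
Qed.

(** Taking normal forms commutes with the two projections of words over [X * Y],
    and the projections together determine the word.  As [p] enters the right
    side only through its image in the Segre product, this bounds the kernel of
    [free_lift w]. *)
Lemma reduce_circ_lift p v :
  (reduce o p)@_v =
  tlift (fun a b => nf_coeff oX (FMonom (map fst v)) a *
                    nf_coeff oY (FMonom (map snd v)) b : k^o)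
    (val (free_lift w p)).
Proof.
set B := (fun a b => _).
have linl b : linear (B^~ b).
  by move=> c x y; rewrite /B (nf_coeff_linear oX rE) mulrDl -mulrA.
have linr a : linear (B a).
  by move=> c x y; rewrite /B (nf_coeff_linear oY sE) mulrDr mulrCA.
have linB := tlift_linear linl linr.
elim/free_ind: p => [|c u p IH].
  rewrite (linear0 (reduce o)) (linear0 (free_lift w)) mcoeff0.
  by have := linB (-1) 0 0; rewrite scaler0 addr0 scaleN1r addNr.
rewrite reduce_linear mcoeffD mcoeffZ free_lift_linear.
apply: etrans (esym (linB _ _ _)); congr (_ * _ + _); last exact: IH.
rewrite val_circ_lift tliftE // /B (nf_coeff_pi oX rE) (nf_coeff_pi oY sE).
rewrite !reduce_word !mcoeff_word.
rewrite -natrM mulnb; congr (_%:R); congr nat_of_bool.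
rewrite -!(inj_eq val_inj) /=.
rewrite -[oX]/(fst o) -[oY]/(snd o) -!map_nf.
apply/eqP/andP => [->|[/eqP E1 /eqP E2]]; first by rewrite !eqxx.
by rewrite -[LHS]zip_unzip -[RHS]zip_unzip /unzip1 /unzip2 E1 E2.
Qed.

Lemma circ_lift_ker p : free_lift w p = 0 <-> reduce o p = 0.
Proof.
split=> [p0|/ideal_Re_redP].
  apply/malgP => v; rewrite reduce_circ_lift p0 mcoeff0.
  have := reduce_circ_lift 0 v.
  rewrite (linear0 (free_lift w)) (linear0 (reduce o)) mcoeff0.
  exact: esym.
elim=> [|q q' _ IHq _ IHq'|a z b [[x y] _ <-]]; first exact: linear0.
  by rewrite raddfD /= IHq IHq' addr0.
have liftM := (free_lift_monoid_morphism w).2.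
suff F0 : free_lift w (F_rel k o x y) = 0.
  by rewrite (liftM (a * _) b) (liftM a) F0 mulr0 mul0r.
apply/eqP; rewrite /F_rel linearB subr_eq0; apply/eqP.
apply: etrans (liftM _ _) _; apply: etrans _ (esym (liftM _ _)).
by rewrite !free_lift_var; apply: circ_mul.
Qed.

Lemma circ_presentation : presentation w (ideal_gen (Re_red k o)).
Proof.
exists (free_lift w); split=> [z|a|p].
- exact: free_lift_var.
- exact: circ_lift_surj.
apply: iff_trans (circ_lift_ker p) _.
exact: iff_sym (ideal_Re_redP o p).
Qed.

Lemma circ_inj : injective w.
Proof.
move=> x y; rewrite -!(free_lift_var w) => /eqP; rewrite -subr_eq0 -linearB.
move=> /eqP/circ_lift_ker/eqP; rewrite linearB /= !reduce_var subr_eq0.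
by move=> /eqP/word_inj; rewrite !fmuE => -[].
Qed.

Lemma segre_cartesian_isomorphic :
  graded_isomorphic AB (yb_algebra k (cartesian_solution r s)).
Proof.
have rsE z : cartesian_solution r s z = ((f z.2.1, g z.2.2), z.2).
  by case: z => x [y y']; rewrite /cartesian_solution rE sE.
apply: (@same_kernel_isomorphic k (free_alg k W) _ _ (free_lift w)
  (quot_pi (yb_relators k (cartesian_solution r s)))).
- exact: circ_lift_surj.
- by move=> b; exists (quot_repr b); apply: quot_reprK.
- move=> p; have := yb_piP (Psi := fun z => (f z.1, g z.2)) o rsE p 0.
  rewrite (linear0 (reduce o)) raddf0 => piE.
  exact: iff_trans (circ_lift_ker p) (iff_sym piE).
- exact: free_lift_hcomp circ_homogeneous.
by move=> d p; apply: esym (quot_hcompE _ d p).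
Qed.

End SegrePresentation.

(** * The standard presentation *)

Lemma card_Re_red (k : fieldType) (disp : Order.disp_t) (W : orderType disp)
    (o : W) (e : seq W) :
  (forall x : W, (o <= x)%O) -> uniq e -> (forall x, x \in e) ->
  Re_red k o #= `I_(size e * (size e - 1)).
Proof.
move=> o_min Ue e_full.
(* There are size e - 1 choices of p <> o and size e choices of q. *)
pose s := [seq (p, q) | p <- rem o e, q <- e].
have sP p q : ((p, q) \in s) = (p != o).
  apply/allpairsP/idP => [[[p' q'] /= [+ _ [-> _]]]|po].
    by rewrite mem_rem_uniq // inE => /andP[].
  by exists (p, q); rewrite /= mem_rem_uniq // inE po !e_full.
have D_s : [set pq : W * W | pq.1 != o] = [set` [fset x in s]%fset].
  apply: funext => -[p q] /=; apply: propext; rewrite -(sP p q) inE.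
  by split; apply.
apply: (card_eq_trans (B := [set pq : W * W | pq.1 != o])).
  apply: inj_card_eq => -[p q] [p' q'] /set_mem /= po /set_mem /= po'.
  by move=> /(F_rel_inj o_min po po') [-> ->].
rewrite D_s; apply/card_eq_fsetP; rewrite card_fseq undup_id.
  by rewrite size_allpairs size_rem // mulnC subn1.
apply: allpairs_uniq => //; first exact: rem_uniq.
by move=> [? ?] [? ?].
Qed.

Theorem theorem7p9 (k : fieldType) (m n : nat) (hm : (1 < m)%N) (hn : (1 < n)%N)
    (f : {perm 'I_m}) (phi : {perm 'I_n}) :
  let r_f := perm_solution f in
  let r_phi := perm_solution phi in
  let AB := segre (yb_algebra k r_f) (yb_algebra k r_phi) in
  let W := ('I_m *l 'I_n)%type in
  let w : W -> AB := circ k r_f r_phi in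
  let w11 : W := (Ordinal (ltnW hm), Ordinal (ltnW hn)) in
  let I := ideal_gen (Re_red k w11) in
  [/\ [/\ injective w /\ forall z, homogeneous 1 (w z),
          PBW_algebra w /\ presentation w I,
          Re_red k w11 #= `I_(m * n * (m * n - 1)) /\
            forall g, Re_red k w11 g -> homogeneous 2 g,
          forall p q : W, p <> w11 ->
            leading_monomial (F_rel k w11 p q) (fmmul (fmu p) (fmu q)) &
          reduced_groebner_basis (Re_red k w11) I],
      exists2 Psi : {perm W},
        (forall i a, Psi (i, a) = (f i, phi a)) &
        I = ideal_gen (Re_segre k Psi) &
      graded_isomorphic AB (yb_algebra k (cartesian_solution r_f r_phi))].
Proof.
move=> r_f r_phi AB W w w11 I.
have w11_min (x : W) : (w11 <= x)%O.
  by rewrite leEprodlexi !leEord /= leq0n; apply/implyP.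
split; last first.
- exact: (segre_cartesian_isomorphic k (Ordinal (ltnW hm)) (Ordinal (ltnW hn))
    (f := f) (g := phi)).
- have PsiI : injective (fun z : W => (f z.1, phi z.2) : W).
    by move=> [x y] [x' y'] /= [/perm_inj -> /perm_inj ->].
  exists (perm PsiI) => [i a|]; first by rewrite permE.
  apply: funext => p; apply: propext.
  exact: iff_trans (ideal_Re_redP w11 p) (iff_sym (ideal_Re_segreP w11 _ p)).
have pres : presentation w I.
  exact: (circ_presentation k (Ordinal (ltnW hm)) (Ordinal (ltnW hn))
    (f := f) (g := phi)).
have Re2 g : Re_red k w11 g -> homogeneous 2 g.
  by move=> [[p q] _ <-]; apply: homogeneousB; apply: varM_homogeneous.
split.
- split; last exact: circ_homogeneous.
  exact: (circ_inj (k := k) (Ordinal (ltnW hm)) (Ordinal (ltnW hn))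
    (f := f) (g := phi)).
- split=> //; exists I, (Re_red k w11); split=> //.
  exact: Re_red_groebner.
- split=> //; pose e := enum {: 'I_m * 'I_n}.
  have e_full x : x \in e by rewrite mem_enum.
  have sz_e : size e = (m * n)%N by rewrite -cardE card_prod !card_ord.
  by rewrite -sz_e; apply: (card_Re_red k w11_min (enum_uniq _) e_full).
- by move=> p q /eqP; apply: leading_F_rel.
- exact: Re_red_reduced.
Qed.
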